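(* Let $k$ be an uncountable algebraically closed field of characteristic $p>0$, $p\neq 2$, and let $R=k[[x_0,\dots,x_d]]/(f)$ be a $d$-dimensional singular (i.e. non-regular) hypersurface. Then $$\operatorname{e}_{HK}\Big(k[[x_0,\dots,x_d]]/\big(\textstyle\sum_{i=0}^d x_i^2\big)\Big)\le \operatorname{e}_{HK}(R).$$
   Context: For a $d$-dimensional Noetherian local ring $(A,\mathfrak m)$ of characteristic $p>0$, $\mathfrak m^{[q]}=(a^q:a\in\mathfrak m)$ for $q=p^e$, and $\operatorname{e}_{HK}(A)=\lim_{q\to\infty}\lambda(A/\mathfrak m^{[q]})/q^d$, where $\lambda$ denotes length. *)

(* Defs.v *)
From HB Require Import structures.
From mathcomp Require Import all_boot all_order all_algebra.
From mathcomp Require Import all_classical all_reals all_analysis.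
Set Implicit Arguments. Unset Strict Implicit. Unset Printing Implicit Defensive.
Import Order.TTheory GRing.Theory Num.Theory numFieldNormedType.Exports.
Local Open Scope classical_set_scope.
Local Open Scope ring_scope.

Definition monom (n : nat) := {ffun 'I_n -> nat}.

Definition powser (k : fieldType) (n : nat) := monom n -> k.

Section PS.
Variables (k : fieldType) (n : nat).
Implicit Types F G : powser k n.

Definition mon0 : monom n := [ffun _ => 0%N].
Definition ps_zero : powser k n := fun _ => 0.
Definition ps_one : powser k n := fun m => (m == mon0)%:R.
Definition ps_add F G : powser k n := fun m => F m + G m.
(* Cauchy product: (FG)_m = sum_{a + b = m} F_a G_b ; a ranges over a <= m. *)
Definition ps_mul F G : powser k n := fun m =>
  \sum_(a : {ffun 'I_n -> 'I_(\sum_(i < n) m i).+1} | [forall i, (a i <= m i)%N])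
     F [ffun i => nat_of_ord (a i)] * G [ffun i => (m i - a i)%N].
Definition ps_pow F (q : nat) : powser k n := iter q (ps_mul F) ps_one.
Definition ps_var (i : 'I_n) : powser k n :=
  fun m => (m == [ffun j => nat_of_bool (j == i)])%:R.

Definition maxideal : set (powser k n) := [set F | F mon0 = 0].

Definition is_ideal (I : set (powser k n)) : Prop :=
  [/\ I ps_zero, (forall F G, I F -> I G -> I (ps_add F G))
    & (forall s F, I F -> I (ps_mul s F))].

Definition ideal_gen (S : set (powser k n)) : set (powser k n) :=
  [set F | forall I, is_ideal I -> S `<=` I -> I F].

(* existence of a strictly increasing chain of ideals J = I_0 < ... < I_N = whole ring;
   via the correspondence theorem these are the chains of submodules of S/J *)
Definition has_chain (J : set (powser k n)) (N : nat) : Prop :=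
  exists c : nat -> set (powser k n),
    [/\ c 0%N = J, c N = setT, (forall i, (i <= N)%N -> is_ideal (c i))
      & (forall i, (i < N)%N -> c i `<` c i.+1)].

Definition qlength (R : realType) (J : set (powser k n)) : R :=
  sup [set (N%:R : R) | N in has_chain J].

(* preimage in S of the Frobenius power m_A^[q] of the maximal ideal of A = S/(f):
   the ideal generated by f and all a^q, a in the maximal ideal of S *)
Definition frob_ideal (f : powser k n) (q : nat) : set (powser k n) :=
  ideal_gen ([set f] `|` [set ps_pow a q | a in maxideal]).

End PS.

Definition quadric (k : fieldType) (n : nat) : powser k n :=
  foldr (@ps_add k n) (@ps_zero k n) [seq ps_mul (@ps_var k n i) (@ps_var k n i) | i <- enum 'I_n].

Definition eHK (R : realType) (k : fieldType) (p d : nat) (f : powser k d.+1) : R :=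
  limn ((fun e : nat => qlength R (frob_ideal f (p ^ e)) / ((p ^ e) ^ d)%:R) : R^nat).

Definition uncountable (T : Type) : Prop := ~ exists g : nat -> T, forall y : T, exists i : nat, g i = y.

(* Main.v *)
(** Write S = k[[x_0, ..., x_d]]. For q a power of p, the length of
    S / (f, m^[q]) is the corank phi_f(q) of multiplication by f on the
    q^(d+1)-dimensional algebra S / m^[q].

    The sequence phi_f(q) / q^d converges because it is bounded and nondecreasing.
    Boundedness: if x^u is the leading monomial of f for a weight order, the
    multiples x^a f with x^(a+u) not in m^[q] are independent, so
    phi_f(q) <= |u| q^d. Monotonicity: Frobenius gives
    p^(d+1) phi_f(q) <= phi_(f^p)(pq), and corank is subadditive under products,
    so phi_(f^p)(pq) <= p phi_f(pq).

    It remains to compare phi_f with phi_Q, Q = sum x_i^2, for a fixed q. As f is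
    singular it lies in m^2, so f = x^T B x with B symmetric over S. For all but
    finitely many s in k, the rank of multiplication by f + s Q is at least that of
    f, and B(0) + s is invertible. Modulo a high power of m, the symmetric matrix
    B + s then has a square root P which is a polynomial in B + s, hence symmetric,
    so that f + s Q = sum y_i^2 modulo m^[q] with y = P x. The substitution
    x_i |-> y_i is an automorphism of S / m^[q] taking Q to f + s Q, hence
    phi_Q(q) = phi_(f + s Q)(q) <= phi_f(q). *)

Require Import Defs.
From HB Require Import structures.
From mathcomp Require Import all_boot all_order all_algebra.
From mathcomp Require Import all_classical all_reals all_analysis.
From mathcomp Require Import zify ring.
Set Implicit Arguments. Unset Strict Implicit. Unset Printing Implicit Defensive.
Import Order.TTheory GRing.Theory Num.Theory numFieldNormedType.Exports.
Local Open Scope classical_set_scope.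
Local Open Scope ring_scope.

(** * Power series as a commutative ring *)

Section Monomials.
Variable n : nat.
Implicit Types a b c m : monom n.

Definition madd a b : monom n := [ffun i => (a i + b i)%N].
Definition msub a b : monom n := [ffun i => (a i - b i)%N].
Definition mscale (q : nat) a : monom n := [ffun i => (q * a i)%N].
Definition mvar (i : 'I_n) : monom n := [ffun j => nat_of_bool (j == i)].
Definition mdvd a b := [forall i, (a i <= b i)%N].
Definition mdeg a := (\sum_i a i)%N.

(** These exponents index the monomial basis of S modulo the q-th powers of the variables. A
    duplicate-free list serves both as a summation range and as a numbering of matrix rows. *)
Definition box (q : nat) : seq (monom n) :=
  [seq [ffun i => nat_of_ord (a i)] | a : {ffun 'I_n -> 'I_q}].

Lemma mdvdP a b : reflect (forall i, (a i <= b i)%N) (mdvd a b).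
Proof. exact: forallP. Qed.

Lemma maddC : commutative madd.
Proof. by move=> a b; apply/ffunP=> i; rewrite !ffunE addnC. Qed.

Lemma maddA : associative madd.
Proof. by move=> a b c; apply/ffunP=> i; rewrite !ffunE addnA. Qed.

Lemma madd0m : left_id (mon0 n) madd.
Proof. by move=> a; apply/ffunP=> i; rewrite !ffunE. Qed.

Lemma msubm0 m : msub m (mon0 n) = m.
Proof. by apply/ffunP=> i; rewrite !ffunE subn0. Qed.

Lemma maddK a b : msub (madd a b) a = b.
Proof. by apply/ffunP=> i; rewrite !ffunE addnC addnK. Qed.

Lemma msubK a b : mdvd a b -> madd a (msub b a) = b.
Proof. by move=> /mdvdP ab; apply/ffunP=> i; rewrite !ffunE subnKC. Qed.

Lemma mdvd_madd a b : mdvd a (madd a b).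
Proof. by apply/mdvdP=> i; rewrite ffunE leq_addr. Qed.

Lemma madd_eqE a b m : (madd a b == m) = mdvd a m && (b == msub m a).
Proof.
apply/eqP/andP => [<-|[am /eqP ->]]; last exact: msubK.
by rewrite mdvd_madd maddK.
Qed.

Lemma madd_inj a : injective (madd a).
Proof. by move=> b c e; rewrite -(maddK a b) e maddK. Qed.

Lemma mdegD a b : mdeg (madd a b) = (mdeg a + mdeg b)%N.
Proof. by rewrite /mdeg -big_split; apply: eq_bigr => i _; rewrite ffunE. Qed.

Lemma mdeg_var i : mdeg (mvar i) = 1%N.
Proof.
rewrite /mdeg (bigD1 i) //= big1 => [|j ji]; rewrite ffunE ?eqxx //.
by rewrite (negbTE ji).
Qed.

Lemma leq_mdeg m i : (m i <= mdeg m)%N.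
Proof. by rewrite /mdeg (bigD1 i) //= leq_addr. Qed.

Lemma mdeg_eq0 m : (mdeg m == 0%N) = (m == mon0 n).
Proof.
apply/idP/eqP => [|->]; last by rewrite /mdeg big1 // => i _; rewrite ffunE.
move=> /eqP m0; apply/ffunP => i; rewrite ffunE.
by have := leq_mdeg m i; rewrite m0 leqn0 => /eqP.
Qed.

Lemma mem_box q m : (m \in box q) = [forall i, (m i < q)%N].
Proof.
apply/fintype.imageP/forallP => [[a _ ->] i|mq]; first by rewrite ffunE.
by exists [ffun i => Ordinal (mq i)] => //; apply/ffunP => i; rewrite !ffunE.
Qed.

Lemma box_uniq q : uniq (box q).
Proof.
rewrite map_inj_uniq ?enum_uniq // => a b /ffunP ab.
by apply/ffunP => i; apply: val_inj; have := ab i; rewrite !ffunE.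
Qed.

Lemma size_box q : size (box q) = (q ^ n)%N.
Proof. by rewrite size_image card_ffun !card_ord. Qed.

Lemma box_mdvd q a m : mdvd a m -> m \in box q -> a \in box q.
Proof.
rewrite !mem_box => /mdvdP am /forallP mq.
by apply/forallP => i; apply: leq_ltn_trans (am i) (mq i).
Qed.

Lemma mdeg_box q m : (0 < n)%N -> m \in box q -> (mdeg m < n * q)%N.
Proof.
rewrite mem_box => n0 /forallP mq.
have q0 : (0 < q)%N by apply: leq_ltn_trans (mq (Ordinal n0)).
have : (mdeg m <= \sum_(i < n) q.-1)%N.
  by apply: leq_sum => i _; rewrite -ltnS prednK.
rewrite sum_nat_const card_ord => /leq_ltn_trans; apply.
by rewrite ltn_pmul2l // prednK.
Qed.

Lemma mem_box_mdeg m : m \in box (mdeg m).+1.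
Proof. by rewrite mem_box; apply/forallP => i; rewrite ltnS leq_mdeg. Qed.

Lemma msub_mdvd m a : mdvd (msub m a) m.
Proof. by apply/mdvdP => i; rewrite ffunE leq_subr. Qed.

End Monomials.

(** * The ring structure on power series, coefficient by coefficient *)

Section PowerSeriesRing.
Variables (k : fieldType) (n : nat).
Local Notation S := (powser k n).
Implicit Types F G H : S.

Lemma box_sum (V : nmodType) (E : monom n -> V) K m : m \in box n K ->
  \sum_(a <- box n K | mdvd a m) E a =
  \sum_(a <- box n (mdeg m).+1 | mdvd a m) E a.
Proof.
move=> mK; rewrite -big_filter -[RHS]big_filter; apply: perm_big; apply: uniq_perm.
- by rewrite filter_uniq // box_uniq.
- by rewrite filter_uniq // box_uniq.
move=> a; rewrite !mem_filter; case am: (mdvd a m) => //=.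
by rewrite (box_mdvd am mK) (box_mdvd am (mem_box_mdeg m)).
Qed.

(** The index type in [ps_mul] varies with [m]. Any box containing [m] gives the same sum, so
    several coefficients can share one range. *)
Lemma ps_mul_box F G K m : m \in box n K ->
  ps_mul F G m = \sum_(a <- box n K | mdvd a m) F a * G (msub m a).
Proof.
move=> mK; rewrite box_sum // /ps_mul big_map enumT big_mkcond [RHS]big_mkcond /=.
apply: eq_big => // a _; rewrite /mdvd.
have -> : [forall i, ([ffun i => nat_of_ord (a i)] i <= m i)%N] =
          [forall i, (a i <= m i)%N].
  by apply: eq_forallb => i; rewrite ffunE.
case: ifP => // _; congr (_ * G _); apply/ffunP => i; by rewrite !ffunE.
Qed.

(** With the constraint turned into an indicator, commutativity and associativity reduce to
    exchanging sums. *)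
Lemma ps_mul_sum2 F G K m : m \in box n K ->
  ps_mul F G m =
  \sum_(a <- box n K) \sum_(b <- box n K) (madd a b == m)%:R * (F a * G b).
Proof.
move=> mK; rewrite (ps_mul_box _ _ mK) big_mkcond /=; apply: eq_bigr => a _.
under eq_bigr do rewrite madd_eqE.
case: (boolP (mdvd a m)) => am /=; last by rewrite big1 // => b _; rewrite mul0r.
rewrite (bigD1_seq (msub m a)) ?box_uniq //=; last exact: box_mdvd (msub_mdvd m a) mK.
by rewrite eqxx mul1r big1 ?addr0 // => b /negbTE ->; rewrite mul0r.
Qed.

Lemma ps_mulC : commutative (@ps_mul k n).
Proof.
move=> F G; apply/funext => m; rewrite !(ps_mul_sum2 _ _ (mem_box_mdeg m)).
rewrite exchange_big; apply: eq_bigr => a _; apply: eq_bigr => b _.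
by rewrite maddC [F b * _]mulrC.
Qed.

Lemma ps_mul_sum3 F G H K m : m \in box n K ->
  ps_mul F (ps_mul G H) m =
  \sum_(a <- box n K) \sum_(b <- box n K) \sum_(c <- box n K)
     (madd (madd a b) c == m)%:R * (F a * G b * H c).
Proof.
move=> mK; rewrite (ps_mul_sum2 _ _ mK); apply: eq_bigr => a _.
have E d : d \in box n K -> (madd a d == m)%:R * (F a * ps_mul G H d) =
    \sum_(b <- box n K) \sum_(c <- box n K)
      (madd a d == m)%:R * ((madd b c == d)%:R * (F a * G b * H c)).
  move=> dK; rewrite (ps_mul_sum2 _ _ dK) !mulr_sumr.
  apply: eq_bigr => b _; rewrite !mulr_sumr; apply: eq_bigr => c _.
  by rewrite -!mulrA; congr (_ * _); rewrite mulrCA.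
rewrite big_seq (eq_bigr _ E) -big_seq exchange_big; apply: eq_bigr => b _.
rewrite exchange_big; apply: eq_bigr => c _ /=.
case: (boolP (madd (madd a b) c == m)) => [/eqP e|ne].
  have bcK : madd b c \in box n K.
    by apply: box_mdvd mK; rewrite -e -maddA [madd a _]maddC mdvd_madd.
  rewrite (bigD1_seq (madd b c)) ?box_uniq //= maddA e !eqxx !mul1r.
  by rewrite big1 ?addr0 // => d /negbTE; rewrite eq_sym => ->; rewrite mul0r mulr0.
rewrite mul0r big1 // => d _; case: (madd b c =P d) => [<-|_]; last by rewrite mul0r mulr0.
by rewrite maddA (negbTE ne) mul0r.
Qed.

Lemma ps_mulA : associative (@ps_mul k n).
Proof.
move=> F G H; apply/funext => m; rewrite [in RHS]ps_mulC.
rewrite !(ps_mul_sum3 _ _ _ (mem_box_mdeg m)).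
rewrite [RHS]exchange_big; apply: eq_bigr => a _.
rewrite [RHS]exchange_big; apply: eq_bigr => b _; apply: eq_bigr => c _.
by rewrite [madd (madd c a) b]maddC maddA [madd (madd b c) a]maddC maddA
  -[H c * _ * _]mulrA [H c * _]mulrC.
Qed.

Lemma ps_mul1 : left_id (@ps_one k n) (@ps_mul k n).
Proof.
move=> F; apply/funext => m; rewrite (ps_mul_box _ _ (mem_box_mdeg m)).
have m0 : mdvd (mon0 n) m by apply/mdvdP => i; rewrite ffunE.
rewrite big_mkcond (bigD1_seq (mon0 n)) ?box_uniq //=; last first.
  by rewrite mem_box; apply/forallP => i; rewrite ffunE.
rewrite m0 /ps_one eqxx mul1r msubm0 big1 ?addr0 // => a /negbTE ->.
by rewrite mul0r if_same.
Qed.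

Lemma ps_mulDl : left_distributive (@ps_mul k n) (@ps_add k n).
Proof.
move=> F G H; apply/funext => m; rewrite /ps_add !(ps_mul_box _ _ (mem_box_mdeg m)).
by rewrite -big_split; apply: eq_bigr => a _; rewrite mulrDl.
Qed.

HB.instance Definition _ := GRing.Zmodule.copy S (monom n -> k).

Lemma ps_one_neq0 : @ps_one k n != (0 : S).
Proof.
apply/eqP => /(congr1 (fun F : S => F (mon0 n))); rewrite /ps_one eqxx.
by move/eqP; rewrite oner_eq0.
Qed.

HB.instance Definition _ := GRing.Zmodule_isComNzRing.Build S
  ps_mulA ps_mulC ps_mul1 ps_mulDl ps_one_neq0.

Lemma psD F G m : (F + G) m = F m + G m. Proof. by []. Qed.
Lemma psN F m : (- F) m = - F m. Proof. by []. Qed.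
Lemma psB F G m : (F - G) m = F m - G m. Proof. by []. Qed.
Lemma ps1 m : (1 : S) m = (m == mon0 n)%:R. Proof. by []. Qed.

Lemma ps_sum (I : Type) (r : seq I) (P : pred I) (E : I -> S) m :
  (\sum_(i <- r | P i) E i) m = \sum_(i <- r | P i) E i m.
Proof. by elim/big_rec2: _ => // i x y _ <-. Qed.

Lemma psM F G m :
  (F * G) m = \sum_(a <- box n (mdeg m).+1 | mdvd a m) F a * G (msub m a).
Proof. exact: ps_mul_box (mem_box_mdeg m). Qed.

Lemma ps_powE F q : ps_pow F q = F ^+ q.
Proof. by elim: q => [|q IH]; rewrite ?exprS -?IH. Qed.

Definition psX (a : monom n) : S := fun m => (m == a)%:R.

Lemma psXM a F m : (psX a * F) m = if mdvd a m then F (msub m a) else 0.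
Proof.
rewrite psM; case: ifP => am.
  rewrite big_mkcond (bigD1_seq a) ?box_uniq ?(box_mdvd am (mem_box_mdeg m)) //=.
  rewrite am /psX eqxx mul1r big1 ?addr0 // => b /negbTE ->.
  by rewrite mul0r if_same.
rewrite big1 // => b bm; rewrite /psX; case: eqP => [e|]; last by rewrite mul0r.
by rewrite -e bm in am.
Qed.

Lemma psXD a b : psX (madd a b) = psX a * psX b.
Proof.
apply/funext => m; rewrite psXM /psX eq_sym madd_eqE [b == _]eq_sym.
by case: mdvd.
Qed.

Lemma psX0 : psX (mon0 n) = 1. Proof. by []. Qed.

Lemma psX_scale q a : psX (mscale q a) = psX a ^+ q.
Proof.
elim: q => [|q IH].
  rewrite expr0 -psX0; congr psX; apply/ffunP => i; by rewrite !ffunE mul0n.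
rewrite exprS -IH -psXD; congr psX; apply/ffunP => i; by rewrite !ffunE mulSn.
Qed.

Definition psC (c : k) : S := fun m => if m == mon0 n then c else 0.

Lemma psCM c F m : (psC c * F) m = c * F m.
Proof.
have m0 : mdvd (mon0 n) m by apply/mdvdP => i; rewrite ffunE.
rewrite psM big_mkcond (bigD1_seq (mon0 n)) ?box_uniq //=; last first.
  by rewrite mem_box; apply/forallP => i; rewrite ffunE.
rewrite m0 /psC eqxx msubm0 big1 ?addr0 // => a /negbTE ->.
by rewrite mul0r if_same.
Qed.

Lemma psC_zmod_morphism : zmod_morphism psC.
Proof. by move=> a b; apply/funext => m; rewrite psB /psC; case: ifP; rewrite ?subr0. Qed.

Lemma psC_monoid_morphism : monoid_morphism psC.
Proof.
split=> [|a b]; first by apply/funext => m; rewrite ps1 /psC; case: ifP.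
by apply/funext => m; rewrite psCM /psC; case: ifP; rewrite ?mulr0.
Qed.

HB.instance Definition _ := GRing.isZmodMorphism.Build k S psC psC_zmod_morphism.
HB.instance Definition _ := GRing.isMonoidMorphism.Build k S psC psC_monoid_morphism.

Lemma ps_at0M F G : (F * G) (mon0 n) = F (mon0 n) * G (mon0 n).
Proof.
rewrite psM (eq_bigl (pred1 (mon0 n))) => [|a]; last first.
  by apply/mdvdP/eqP => [am|-> i]; last rewrite ffunE //;
     apply/ffunP => i; have := am i; rewrite !ffunE leqn0 => /eqP.
rewrite big_mkcond (bigD1_seq (mon0 n)) ?box_uniq //= ?eqxx; last first.
  by rewrite mem_box; apply/forallP => i; rewrite ffunE.
by rewrite msubm0 big1 ?addr0 // => a /negbTE ->.
Qed.

Definition ps_at0 F := F (mon0 n).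

Lemma ps_at0_zmod_morphism : zmod_morphism ps_at0. Proof. by []. Qed.
Lemma ps_at0_monoid_morphism : monoid_morphism ps_at0.
Proof. by split=> [|F G]; rewrite /ps_at0 ?ps1 ?eqxx // ps_at0M. Qed.

HB.instance Definition _ := GRing.isZmodMorphism.Build S k ps_at0 ps_at0_zmod_morphism.
HB.instance Definition _ := GRing.isMonoidMorphism.Build S k ps_at0 ps_at0_monoid_morphism.

End PowerSeriesRing.

(** * The ideals m^[q] and powers of m *)

Section Ideals.
Variables (k : fieldType) (n : nat).
Local Notation S := (powser k n).
Implicit Types F G H : S.

(* For q a power of the characteristic this is m^[q], for every q the ideal
   generated by the q-th powers of the variables. *)
Definition offbox (q : nat) : set S := [set F | forall m, m \in box n q -> F m = 0].
Definition order_ge (N : nat) : set S := [set F | forall m, (mdeg m < N)%N -> F m = 0].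

Lemma offboxD q F G : offbox q F -> offbox q G -> offbox q (F + G).
Proof. by move=> hF hG m mq; rewrite psD hF // hG // addr0. Qed.

Lemma offboxM q F G : offbox q G -> offbox q (F * G).
Proof.
move=> hG m mq; rewrite psM big1 // => a am.
by rewrite hG ?mulr0 //; apply: box_mdvd (msub_mdvd m a) mq.
Qed.

Lemma offbox_psX q a : a \notin box n q -> offbox q (psX k a).
Proof. by move=> aq m mq; rewrite /psX; case: eqP => // e; rewrite -e mq in aq. Qed.

Lemma order_ge_sum N (I : Type) (r : seq I) (P : pred I) (E : I -> S) :
  (forall i, P i -> order_ge N (E i)) -> order_ge N (\sum_(i <- r | P i) E i).
Proof. by move=> hE m mq; rewrite ps_sum big1 // => i Pi; apply: hE. Qed.

Lemma order_geM a b F G : order_ge a F -> order_ge b G -> order_ge (a + b) (F * G).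
Proof.
move=> hF hG m mab; rewrite psM big1 // => c cm.
have : (mdeg c + mdeg (msub m c) < a + b)%N by rewrite -mdegD msubK.
case: (ltnP (mdeg c) a) => [ca _|ac h]; first by rewrite hF ?mul0r.
rewrite [G _]hG ?mulr0 //; lia.
Qed.

Lemma order_geX N F : order_ge 1 F -> order_ge N (F ^+ N).
Proof. by move=> hF; elim: N => // N IH; rewrite exprS -add1n; apply: order_geM. Qed.

Lemma order_ge1P F : order_ge 1 F <-> maxideal F.
Proof.
split=> [hF|F0 m]; first by apply: hF; rewrite ltnS leqn0 mdeg_eq0.
by rewrite ltnS leqn0 mdeg_eq0 => /eqP ->.
Qed.

Lemma maxideal_psX (i : 'I_n) : maxideal (psX k (mvar i)).
Proof. by apply/order_ge1P => m h; rewrite /psX; case: eqP h => // ->; rewrite mdeg_var. Qed.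

Lemma order_ge_offbox q F : (0 < n)%N -> order_ge (n * q) F -> offbox q F.
Proof. by move=> n0 hF m mq; apply: hF; apply: mdeg_box. Qed.

(** Every monomial outside the box is divisible by some x_i^q. The order clause holds because
    dividing by x_i^q lowers degrees by exactly q. *)
Lemma offbox_split q F : (0 < q)%N -> offbox q F ->
  exists2 G : 'I_n -> S, F = \sum_i psX k (mvar i) ^+ q * G i
    & forall N, order_ge (q + N) F -> forall i, order_ge N (G i).
Proof.
move=> q0 hF.
(* [pick] assigns each monomial to a single divisible variable, so no coefficient of [F] is counted
   twice. *)
pose G i : S := fun m => let m' := madd (mscale q (mvar i)) m in
  if [pick j | (q <= m' j)%N] == Some i then F m' else 0.
exists G => [|N oF i m mN]; last first.
  rewrite /G; case: ifP => // _; apply: oF; rewrite mdegD.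
  suff -> : mdeg (mscale q (mvar i)) = q by rewrite ltn_add2l.
  rewrite /mdeg (eq_bigr (fun j => q * mvar i j))%N => [|j _]; last by rewrite ffunE.
  by rewrite -big_distrr -/(mdeg _) mdeg_var /= muln1.
apply/funext => m; rewrite ps_sum.
have E i : (psX k (mvar i) ^+ q * G i) m =
    if [pick j | (q <= m j)%N] == Some i then F m else 0.
  rewrite -psX_scale psXM; case: (boolP (mdvd _ m)) => [im|/mdvdP nim].
    by rewrite /G msubK.
  case: pickP => // j qj; case: eqP => // -[e]; subst j; case: nim => j.
  by rewrite !ffunE; case: eqP => [->|_]; rewrite ?muln1 ?muln0.
rewrite (eq_bigr _ (fun i _ => E i)).
case: pickP => [j qj|mq]; last first.
  rewrite big1 // hF // mem_box; apply/forallP => i; rewrite ltnNge.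
  by apply/negP => h; have := mq i; rewrite h.
by rewrite (bigD1 j) //= eqxx big1 ?addr0 // => i ij; case: eqP => // -[e];
   rewrite e eqxx in ij.
Qed.

Lemma order_ge_split N F : order_ge N.+1 F ->
  exists2 G : 'I_n -> S, F = \sum_i psX k (mvar i) * G i
    & forall i, order_ge N (G i).
Proof.
move=> oF; have [|G FG oG] := @offbox_split 1 F isT.
  move=> m; rewrite mem_box => /forallP m0; apply: oF.
  rewrite [mdeg m]big1 // => i _; have := m0 i.
  by rewrite ltnS leqn0 => /eqP.
by exists G => //; apply: oG; rewrite add1n.
Qed.

(** Geometric series in [H], the defect of [F] divided by its constant term. Since H^j has order at
    least j, each coefficient of the inverse is read off a partial sum. *)
Lemma ps_unit F : F (mon0 n) != 0 -> exists W, W * F = 1.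
Proof.
move=> F0; pose H := 1 - psC (F (mon0 n))^-1 * F.
have oH : order_ge 1 H.
  by apply/order_ge1P; rewrite /maxideal /= /H psB ps1 eqxx psCM mulVf // subrr.
pose W : S := fun m => (\sum_(j < (mdeg m).+1) H ^+ j) m.
have Wtr N m : (mdeg m < N)%N -> W m = (\sum_(j < N) H ^+ j) m.
  move=> mN; rewrite /W !ps_sum -(subnKC mN) big_split_ord /=.
  rewrite [X in _ = _ + X]big1 ?addr0 // => j _.
  by apply: (order_geX oH); rewrite leq_addr.
have WH : W * (1 - H) = 1.
  apply/funext => m; set N := (mdeg m).+1.
  have -> : (W * (1 - H)) m = ((\sum_(j < N) H ^+ j) * (1 - H)) m.
    rewrite !psM; apply: eq_bigr => a /mdvdP am; rewrite (Wtr N) //.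
    by rewrite ltnS; apply: leq_sum => i _.
  rewrite mulrC -[1 - H]opprB mulNr -subrX1 opprB psB ps1.
  by rewrite (order_geX oH) ?subr0 // /N.
by exists (W * psC (F (mon0 n))^-1); rewrite -mulrA -[RHS]WH /H subKr.
Qed.

Lemma is_idealE (I : set S) : is_ideal I <->
  [/\ I 0, forall F G, I F -> I G -> I (F + G) & forall s F, I F -> I (s * F)].
Proof. by []. Qed.

(** * Frobenius powers, for q a power of the characteristic *)

Section Frobenius.
Variable q : nat.
Hypothesis qp : [pchar k].-nat q.

Lemma ps_pchar : [pchar S].-nat q.
Proof.
apply/andP; split; first by case/andP: qp.
by apply: sub_all (proj2 (andP qp)) => p; apply: (rmorph_pchar (@psC k n)).
Qed.

Lemma ps_frobD F G : (F + G) ^+ q = F ^+ q + G ^+ q.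
Proof. exact: exprDn_pchar ps_pchar. Qed.

Lemma ps_frob_sum (I : Type) (r : seq I) (P : pred I) (E : I -> S) :
  (\sum_(i <- r | P i) E i) ^+ q = \sum_(i <- r | P i) E i ^+ q.
Proof.
apply: (big_morph _ ps_frobD); rewrite expr0n.
by case/andP: qp; case: q.
Qed.

Definition box_trunc K F := \sum_(a <- box n K) psC (F a) * psX k a.

Lemma box_truncP K F : offbox K (F - box_trunc K F).
Proof.
move=> m mK; rewrite psB /box_trunc ps_sum (bigD1_seq m) ?box_uniq //=.
rewrite psCM /psX eqxx mulr1 big1 ?addr0 ?subrr // => a; rewrite psCM eq_sym.
by move=> /negbTE ->; rewrite mulr0.
Qed.

(* Frobenius is not visibly additive for infinite sums, but a single
   coefficient only sees the truncation of F to a box. *)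
Lemma ps_frob_coef F m :
  (F ^+ q) m = if [forall i, (q %| m i)%N] then F [ffun i => (m i %/ q)%N] ^+ q else 0.
Proof.
have q0 : (0 < q)%N by case/andP: qp.
set K := (mdeg m).+1; have mK : m \in box n K := mem_box_mdeg m.
have R0 : ((F - box_trunc K F) ^+ q) m = 0.
  apply: (_ : offbox K _) mK; rewrite -(prednK q0) exprSr.
  by apply: offboxM; apply: box_truncP.
rewrite -[F in LHS](subrK (box_trunc K F)) ps_frobD psD R0 add0r.
rewrite /box_trunc ps_frob_sum ps_sum.
have E a : ((psC (F a) * psX k a) ^+ q) m = F a ^+ q * (m == mscale q a)%:R.
  by rewrite exprMn -rmorphXn -psX_scale psCM.
rewrite (eq_bigr _ (fun a _ => E a)); case: ifP => [/forallP qm|/forallP qm].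
  pose b : monom n := [ffun i => (m i %/ q)%N].
  have eb : m = mscale q b by apply/ffunP => i; rewrite !ffunE mulnC divnK.
  rewrite (bigD1_seq b) ?box_uniq //=; last first.
    by apply: box_mdvd mK; apply/mdvdP => i; rewrite ffunE leq_div.
  rewrite -eb eqxx mulr1 big1 ?addr0 // => a ab.
  case: eqP => [e|]; last by rewrite mulr0.
  suff e' : a = b by rewrite e' eqxx in ab.
  by apply/ffunP => i; rewrite ffunE e ffunE mulKn.
rewrite big1 // => a _; case: eqP => [e|]; last by rewrite mulr0.
by case: qm => i; rewrite e ffunE dvdn_mulr.
Qed.

(** Inside the box the only exponent divisible by q is zero, and there the coefficient is the q-th
    power of the vanishing constant term. *)
Lemma maxideal_frob F : maxideal F -> offbox q (F ^+ q).
Proof.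
move=> F0 m; rewrite mem_box => /forallP mq; rewrite ps_frob_coef.
have q0 : (0 < q)%N by case/andP: qp.
case: ifP => // _; rewrite [F _](_ : _ = 0) ?expr0n ?gtn_eqF //.
rewrite -[RHS]F0; congr F; apply/ffunP => i; by rewrite !ffunE divn_small.
Qed.

Lemma offbox_frob K F : offbox K F -> offbox (q * K) (F ^+ q).
Proof.
move=> hF m; rewrite mem_box => /forallP mq; rewrite ps_frob_coef.
have q0 : (0 < q)%N by case/andP: qp.
case: ifP => // _; rewrite hF ?expr0n ?gtn_eqF // mem_box.
by apply/forallP => i; rewrite ffunE ltn_divLR // mulnC.
Qed.

(** A single multiplier of [f] suffices because the rest is absorbed by the ideal [offbox q]. One
    inclusion is checked on generators, the other splits off the q-th powers of the variables. *)
Lemma frob_idealE f : frob_ideal f q = [set F | exists s, offbox q (F - s * f)].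
Proof.
have q0 : (0 < q)%N by case/andP: qp.
apply/seteqP; split=> F; last first.
  move=> [s /(offbox_split q0) [G FG _]] I /is_idealE[I0 ID IM] HI.
  have -> : F = s * f + \sum_i psX k (mvar i) ^+ q * G i by rewrite -FG addrC subrK.
  apply: (ID); first by apply: (IM); apply: HI; left.
  apply: (big_ind I) => // i _; rewrite mulrC.
  apply: IM; apply: HI; right; exists (psX k (mvar i)); last by rewrite ps_powE.
  exact: maxideal_psX.
apply; [apply/is_idealE; split|].
- by exists 0; rewrite mul0r subr0.
- move=> {}F G [s hs] [t ht]; exists (s + t).
  have -> : F + G - (s + t) * f = (F - s * f) + (G - t * f) by ring.
  exact: offboxD.
- move=> t {}F [s hs]; exists (t * s).
  have -> : t * F - t * s * f = t * (F - s * f) by ring.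
  exact: offboxM.
- move=> G [->|[a am <-]]; first by exists 1; rewrite mul1r subrr.
  by exists 0; rewrite mul0r subr0 ps_powE; apply: maxideal_frob.
Qed.

End Frobenius.
End Ideals.

(** * Length as a corank *)

Lemma rank_adds_row (k : fieldType) m (U : 'M[k]_m) (v : 'rV[k]_m) :
  ~~ (v <= U)%MS -> \rank (U + v)%MS = (\rank U).+1.
Proof.
move=> vU; apply/eqP; rewrite eqn_leq; apply/andP; split.
  apply: leq_trans (mxrank_adds_leqif U v) _.
  by rewrite -[X in (_ <= X)%N]addn1 leq_add2l rank_leq_row.
apply: rank_ltmx; rewrite ltmxE addsmxSl; apply: contra vU.
by apply: submx_trans; apply: addsmxSr.
Qed.

(** Take [U] of maximal rank with row space inside [P]. A vector of [P] outside that row space could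
    be adjoined and would raise the rank. *)
Lemma set_rowspace (k : fieldType) m (P : set 'rV[k]_m) :
  P 0 -> (forall u v, P u -> P v -> P (u + v)) -> (forall c u, P u -> P (c *: u)) ->
  exists U : 'M[k]_m, forall v, P v <-> (v <= U)%MS.
Proof.
move=> P0 PD PZ.
pose inP r := `[< exists2 U : 'M[k]_m, \rank U = r & forall v, (v <= U)%MS -> P v >].
have ex0 : exists r, inP r.
  exists 0%N; apply/asboolP; exists 0; first exact: mxrank0.
  by move=> v /submx0null ->.
have ub r : inP r -> (r <= m)%N by move=> /asboolP[U <- _]; exact: rank_leq_row.
case: (ex_maxnP ex0 ub) => r /asboolP[U rU PU] rmax.
exists U => v; split; last exact: PU.
move=> Pv; apply/negPn/negP => vU.
have : (r < \rank (U + v)%MS)%N by rewrite rank_adds_row // rU.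
rewrite ltnNge => /negP; apply; apply: rmax; apply/asboolP.
exists (U + v)%MS => // w /sub_addsmxP[[a b] /= ->]; apply: PD.
  by apply: PU; apply: submxMl.
by rewrite [b]mx11_scalar mul_scalar_mx; apply: PZ.
Qed.

(** * Linear algebra on the truncated algebra, and chains of ideals *)

Section Truncation.
Variables (k : fieldType) (n q : nat).
Local Notation S := (powser k n).
Local Notation D := (size (box n q)).
Implicit Types F G f : S.

Definition bx (i : 'I_D) : monom n := nth (mon0 n) (box n q) i.
Definition tr F : 'rV[k]_D := \row_j F (bx j).

(* The matrix, acting on rows, of multiplication by f on the quotient by [offbox q]. *)
Definition mulM f : 'M[k]_D := \matrix_i tr (psX k (bx i) * f).

Lemma bx_mem i : bx i \in box n q.
Proof. exact: mem_nth. Qed.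

Lemma bx_inj : injective bx.
Proof.
move=> i j /eqP; rewrite nth_uniq ?box_uniq ?ltn_ord // => /eqP.
exact: val_inj.
Qed.

Lemma bxP a : a \in box n q -> exists i, bx i = a.
Proof. by move=> /(nthP (mon0 n))[i iD <-]; exists (Ordinal iD). Qed.

Lemma trD F G : tr (F + G) = tr F + tr G.
Proof. by apply/rowP => j; rewrite !mxE. Qed.

Lemma trB F G : tr (F - G) = tr F - tr G.
Proof. by apply/rowP => j; rewrite !mxE. Qed.

Lemma trC c F : tr (psC c * F) = c *: tr F.
Proof. by apply/rowP => j; rewrite !mxE psCM. Qed.

Lemma tr_sum (I : Type) (r : seq I) (P : pred I) (E : I -> S) :
  tr (\sum_(i <- r | P i) E i) = \sum_(i <- r | P i) tr (E i).
Proof.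
apply/rowP => j; rewrite summxE mxE ps_sum; apply: eq_bigr => i _.
by rewrite mxE.
Qed.

Lemma tr_eq0 F : tr F = 0 <-> offbox q F.
Proof.
split=> [/rowP h m /bxP[i <-]|h]; first by have := h i; rewrite !mxE.
by apply/rowP => j; rewrite !mxE h // bx_mem.
Qed.

Lemma tr_eq F G : tr F = tr G <-> offbox q (F - G).
Proof.
rewrite -tr_eq0 trB; split=> [->|/eqP]; first by rewrite subrr.
by rewrite subr_eq0 => /eqP.
Qed.

Lemma tr_psX i : tr (psX k (bx i)) = delta_mx 0 i.
Proof. by apply/rowP => j; rewrite !mxE /psX (inj_eq bx_inj) eqxx. Qed.

Definition lift_row (u : 'rV[k]_D) : S := \sum_i psC (u 0 i) * psX k (bx i).

Lemma lift_rowK u : tr (lift_row u) = u.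
Proof.
rewrite tr_sum [RHS]row_sum_delta; apply: eq_bigr => i _.
by rewrite trC tr_psX.
Qed.

(** The truncation of a product depends only on that of [F], so [F] may be replaced by a combination
    of box monomials, where linearity applies. *)
Lemma trM F f : tr (F * f) = tr F *m mulM f.
Proof.
have -> : tr (F * f) = tr (lift_row (tr F) * f).
  apply/tr_eq; rewrite -mulrBl mulrC; apply: offboxM.
  by apply/tr_eq; rewrite lift_rowK.
rewrite mulr_suml tr_sum mulmx_sum_row; apply: eq_bigr => i _.
by rewrite -mulrA trC rowK.
Qed.

Lemma mulMM f g : mulM (f * g) = mulM f *m mulM g.
Proof. by apply/row_matrixP => i; rewrite row_mul !rowK mulrA trM. Qed.

Lemma mulMD f g : mulM (f + g) = mulM f + mulM g.
Proof. by apply/row_matrixP => i; rewrite [RHS]linearD /= !rowK mulrDr trD. Qed.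

Lemma mulMC c f : mulM (psC c * f) = c *: mulM f.
Proof. by apply/row_matrixP => i; rewrite [RHS]linearZ /= !rowK mulrCA trC. Qed.

Lemma mulM_eq f g : offbox q (f - g) -> mulM f = mulM g.
Proof.
move=> fg; apply/row_matrixP => i; rewrite !rowK; apply/tr_eq.
by rewrite -mulrBr; apply: offboxM.
Qed.

Lemma ideal_rowspace (J : set S) : is_ideal J -> offbox q `<=` J ->
  exists U : 'M[k]_D, forall F, J F <-> (tr F <= U)%MS.
Proof.
move=> /is_idealE[J0 JD JM] qJ.
have [|u v|c u|U HU] := @set_rowspace _ D [set v | exists2 F, J F & tr F = v].
- by exists 0 => //; apply/tr_eq0.
- by move=> [F JF <-] [G JG <-]; exists (F + G); [exact: JD|rewrite trD].
- by move=> [F JF <-]; exists (psC c * F); [exact: JM|rewrite trC].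
exists U => F; split=> [JF|/HU [G JG /esym/tr_eq e]]; first by apply/HU; exists F.
by rewrite -(subrK G F); apply: JD => //; apply: qJ.
Qed.

(** Each strict inclusion of ideals is a strict inclusion of row spaces, hence raises the rank by at
    least one. *)
Lemma has_chain_leq (J : set S) (U : 'M[k]_D) N :
  offbox q `<=` J -> (forall F, J F <-> (tr F <= U)%MS) ->
  has_chain J N -> (N + \rank U <= D)%N.
Proof.
move=> qJ JU [c [c0 cN cI clt]].
have qc i : (i <= N)%N -> offbox q `<=` c i.
  elim: i => [_|i IH iN]; first by rewrite c0.
  by apply: subset_trans (IH (ltnW iN)) _; apply: properW; apply: clt.
suff H i : (i <= N)%N -> forall V : 'M[k]_D, (forall F, c i F <-> (tr F <= V)%MS) ->
    (i + \rank U <= \rank V)%N.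
  have [V cV] := ideal_rowspace (cI N (leqnn N)) (qc N (leqnn N)).
  by apply: leq_trans (H N (leqnn N) V cV) (rank_leq_row V).
elim: i => [_ V cV|i IH iN V cV].
  rewrite add0n; apply: mxrankS; apply/row_subP => i.
  by rewrite -(lift_rowK (row i U)); apply/cV; rewrite c0; apply/JU; rewrite lift_rowK row_sub.
have [W cW] := ideal_rowspace (cI i (ltnW iN)) (qc i (ltnW iN)).
rewrite addSn; apply: leq_ltn_trans (IH (ltnW iN) W cW) _.
have [sub nsub] := clt i iN.
apply: rank_ltmx; rewrite ltmxE; apply/andP; split; last first.
  by apply/negP => VW; apply: nsub => F /cV FV; apply/cW; apply: submx_trans FV VW.
apply/row_subP => j; rewrite -(lift_rowK (row j W)); apply/cV; apply: sub.
by apply/cW; rewrite lift_rowK row_sub.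
Qed.

(** The monomial is a socle element modulo [J]: every variable kills it, so a series multiplies it
    through its constant term alone and adding its k-line keeps an ideal. *)
Lemma ideal_adjoin (J : set S) a : is_ideal J -> ~ J (psX k a) ->
  (forall i, J (psX k (madd (mvar i) a))) ->
  is_ideal [set F | exists c, J (F - psC c * psX k a)].
Proof.
move=> /is_idealE[J0 JD JM] Ja Jmax; apply/is_idealE; split.
- by exists 0; rewrite rmorph0 mul0r subr0.
- move=> F G [c hc] [d hd]; exists (c + d).
  have -> : F + G - psC (c + d) * psX k a =
      (F - psC c * psX k a) + (G - psC d * psX k a) by rewrite rmorphD /=; ring.
  exact: JD.
- move=> s F [c hc]; exists (ps_at0 s * c).
  have [|G sG _] := @order_ge_split k n 0 (s - psC (ps_at0 s)).
    by apply/order_ge1P; rewrite /maxideal /= psB /psC eqxx subrr.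
  have -> : s * F - psC (ps_at0 s * c) * psX k a =
      s * (F - psC c * psX k a) + psC c * ((s - psC (ps_at0 s)) * psX k a).
    by rewrite rmorphM /=; ring.
  apply: (JD); apply: (JM) => //; rewrite sG mulr_suml.
  by apply: (big_ind J) => // i _; rewrite mulrC mulrA [_ * psX k (mvar i)]mulrC
    -psXD mulrC; apply: (JM).
Qed.

(** The bound of [has_chain_leq] is attained: adjoining one socle monomial at a time raises the rank
    by exactly one. *)
Lemma has_chain_rank (J : set S) (U : 'M[k]_D) :
  is_ideal J -> offbox q `<=` J -> (forall F, J F <-> (tr F <= U)%MS) ->
  has_chain J (D - \rank U).
Proof.
move: {-1}(D - _)%N (erefl (D - \rank U)%N) => r.
elim: r J U => [|r IH] J U rU idJ qJ JU.
  exists (fun=> J); split=> //; apply/seteqP; split=> // F _; apply/JU.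
  apply: submx_full; rewrite /row_full eqn_leq rank_leq_row /=.
  by rewrite -subn_eq0 rU.
have [i0 Ji0] : exists i, ~ J (psX k (bx i)).
  apply: contrapT => /forallNP h; have : (D <= \rank U)%N.
    rewrite -{1}(mxrank1 k D); apply: mxrankS; apply/row_subP => i.
    by rewrite row1 -tr_psX; apply/JU; apply: contrapT; apply: h.
  by rewrite -subn_eq0 rU.
pose P i := `[< ~ J (psX k (bx i)) >].
have Pi0 : P i0 by apply/asboolP.
(* A monomial of maximal degree among those of the box outside [J] is a socle element: its product
   with a variable either leaves the box or lies in [J] by maximality. *)
case: (@arg_maxnP _ i0 P (fun i => mdeg (bx i)) Pi0) => i /asboolP Ji imax.
set a := bx i in Ji imax.
have Jmax l : J (psX k (madd (mvar l) a)).
  have [/bxP[j ej]|h] := boolP (madd (mvar l) a \in box n q); last first.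
    by apply: qJ; apply: offbox_psX.
  rewrite -ej; apply: contrapT => /asboolP /imax.
  by rewrite /= ej mdegD mdeg_var; lia.
pose J' := [set F | exists c, J (F - psC c * psX k a)].
have idJ' : is_ideal J' by apply: ideal_adjoin.
have JJ' : J `<=` J' by move=> F JF; exists 0; rewrite rmorph0 mul0r subr0.
have J'a : J' (psX k a).
  by exists 1; rewrite rmorph1 mul1r subrr; case/is_idealE: idJ.
have J'U F : J' F <-> (tr F <= U + tr (psX k a))%MS.
  split=> [[c /JU]|/sub_addsmxP[[u v] /= e]].
    rewrite trB trC => h; rewrite -(subrK (c *: tr (psX k a)) (tr F)).
    by rewrite addmx_sub_adds // scalemx_sub.
  exists (v 0 0); apply/JU; rewrite trB trC e [v]mx11_scalar mul_scalar_mx.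
  by rewrite !mxE eqxx mulr1n addrK submxMl.
have rU' : (D - \rank (U + tr (psX k a))%MS = r)%N.
  by rewrite rank_adds_row ?subnS ?rU //; apply/negP => /JU.
have [c [c0 cr cI clt]] := IH J' _ rU' idJ' (subset_trans qJ JJ') J'U.
exists (fun j => if j is j'.+1 then c j' else J); split=> // [[|j]|[|j]] jr //.
- exact: cI.
- by rewrite c0; split=> // /(_ _ J'a).
- exact: clt.
Qed.

Lemma qlength_rank (R : realType) (J : set S) (U : 'M[k]_D) :
  is_ideal J -> offbox q `<=` J -> (forall F, J F <-> (tr F <= U)%MS) ->
  qlength R J = (D - \rank U)%:R.
Proof.
move=> idJ qJ JU; rewrite /qlength; set A := [set _ | _ in _].
have Ach : A (D - \rank U)%:R by exists (D - \rank U)%N => //; apply: has_chain_rank.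
have ubA : ubound A (D - \rank U)%:R.
  move=> _ [N hN <-]; rewrite ler_nat leq_subRL ?rank_leq_row // addnC.
  exact: has_chain_leq hN.
apply/eqP; rewrite eq_le; apply/andP; split.
  by apply: ge_sup => //; exists (D - \rank U)%:R.
by apply: ub_le_sup => //; exists (D - \rank U)%:R.
Qed.

Lemma frob_qlength (R : realType) f : [pchar k].-nat q ->
  qlength R (frob_ideal f q) = (D - \rank (mulM f))%:R.
Proof.
move=> qp; apply: qlength_rank.
- split=> [I [] //|F G hF hG I hI hS|s F hF I hI hS]; case: (hI) => _ hD hM.
    by apply: hD; [apply: hF|apply: hG].
  by apply: hM; apply: hF.
- by move=> F hF; rewrite frob_idealE //; exists 0; rewrite mul0r subr0.
move=> F; rewrite frob_idealE //; split.
  by move=> [s /tr_eq ->]; rewrite trM submxMl.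
move=> /submxP[v Fv]; exists (lift_row v).
by apply/tr_eq; rewrite trM lift_rowK.
Qed.

End Truncation.

(** * Growth of the corank *)

Section Colength.
Variables (k : fieldType) (n : nat).
Local Notation S := (powser k n).
Implicit Types f F : S.

(** By [frob_qlength] this corank is the length of S / (f, m^[q]) when q is a power of the
    characteristic. *)
Definition colen (q : nat) f := (q ^ n - \rank (mulM q f))%N.

Lemma colenE q f : (colen q f + \rank (mulM q f) = q ^ n)%N.
Proof. by rewrite /colen subnK // -size_box rank_leq_row. Qed.

Lemma mulM1 q : mulM q (1 : S) = 1%:M.
Proof. by apply/row_matrixP => i; rewrite rowK row1 mulr1 tr_psX. Qed.

Lemma colenX q f e : (colen q (f ^+ e) <= e * colen q f)%N.
Proof.
elim: e => [|e IH].
  by rewrite expr0 /colen mulM1 mxrank1 -size_box subnn.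
have := mxrank_mul_min (mulM q f) (mulM q (f ^+ e)).
rewrite -mulMM -exprS; have := size_box n q.
have := colenE q (f ^+ e.+1); have := colenE q (f ^+ e); have := colenE q f.
by rewrite mulSn; lia.
Qed.

Lemma mxrank_sum_leq (I : finType) m N (W : I -> 'M[k]_(m, N)) r :
  (forall i, \rank (W i) <= r)%N -> (\rank (\sum_i <<W i>>)%MS <= #|I| * r)%N.
Proof.
move=> Wr; apply: (@leq_trans (\sum_i r)%N); last by rewrite sum_nat_const; apply: leqnn.
elim/big_rec2: _ => [|i x U _ IH]; first by rewrite mxrank0.
apply: leq_trans (mxrank_adds_leqif _ _) _.
by rewrite leq_add // genmxE.
Qed.

(** Writing an exponent as b + p c with b in the box of side p gives x^e f^p = x^b (x^c f)^p. For
    fixed b, expanding x^c f in a basis of the row space of [mulM q f] confines these rows to a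
    space of dimension at most its rank, and there are p^n choices of b. *)
Lemma rank_frob p q f : [pchar k].-nat p ->
  (\rank (mulM (p * q) (f ^+ p)) <= p ^ n * \rank (mulM q f))%N.
Proof.
move=> pp; have p0 : (0 < p)%N by case/andP: pp.
pose B := row_base (mulM q f).
pose W (j : 'I_(size (box n p))) : 'M[k]__ :=
  \matrix_l tr (p * q) (psX k (bx j) * lift_row (row l B) ^+ p).
have Wr j : (\rank (W j) <= \rank (mulM q f))%N by apply: rank_leq_row.
have := mxrank_sum_leq Wr; rewrite card_ord -(size_box n p); apply: leq_trans.
apply: mxrankS; apply/row_subP => i; rewrite rowK; set e := bx i.
pose b : monom n := [ffun l => (e l %% p)%N].
pose c : monom n := [ffun l => (e l %/ p)%N].
have eE : e = madd b (mscale p c).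
  by apply/ffunP => l; rewrite !ffunE addnC mulnC -divn_eq.
have [j jb] : exists j : 'I_(size (box n p)), bx j = b.
  by apply: bxP; rewrite mem_box; apply/forallP => l; rewrite ffunE ltn_mod.
have [i' ic] : exists i' : 'I_(size (box n q)), bx i' = c.
  apply: bxP; rewrite mem_box; apply/forallP => l; rewrite ffunE ltn_divLR // mulnC.
  by have := bx_mem i; rewrite mem_box => /forallP.
have /submxP[v vB] : (tr q (psX k c * f)%R <= B)%MS.
  by rewrite eq_row_base -ic -[tr q _](rowK (fun i => tr q (psX k (bx i) * f))) row_sub.
have off : offbox q (psX k c * f - \sum_l psC (v 0 l) * lift_row (row l B)).
  apply/tr_eq; rewrite vB tr_sum mulmx_sum_row; apply: eq_bigr => l _.
  by rewrite trC lift_rowK.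
have WS : (W j <= \sum_i <<W i>>)%MS by rewrite (sumsmx_sup j) // genmxE.
apply: submx_trans WS.
(* Additivity of Frobenius carries the expansion over, with coefficients raised to the power p; the
   error vanishes because its p-th power lies off the box of side pq. *)
have -> : tr (p * q) (psX k e * f ^+ p) = \sum_l (v 0 l ^+ p) *: row l (W j).
  rewrite eE psXD psX_scale -mulrA -exprMn.
  rewrite -[psX k c * f](subrK (\sum_l psC (v 0 l) * lift_row (row l B))).
  rewrite ps_frobD // mulrDr trD (proj2 (tr_eq0 _ _)) ?add0r; last first.
    by apply: offboxM; apply: offbox_frob.
  rewrite ps_frob_sum // mulr_sumr tr_sum; apply: eq_bigr => l _.
  by rewrite rowK exprMn -rmorphXn mulrCA trC jb.
by apply: summx_sub => l _; apply: scalemx_sub; apply: row_sub.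
Qed.

Lemma colen_frob p q f : [pchar k].-nat p ->
  (p ^ n * colen q f <= p * colen (p * q) f)%N.
Proof.
move=> pp; apply: leq_trans (colenX (p * q) f p).
have := rank_frob q f pp; have := colenE q f; have := colenE (p * q) (f ^+ p).
rewrite expnMn => e e' h; rewrite -e' mulnDr in e; lia.
Qed.

Lemma digits_inj K (a b : 'I_n -> nat) :
  (forall i, a i < K)%N -> (forall i, b i < K)%N ->
  (\sum_i a i * K ^ i = \sum_i b i * K ^ i)%N -> a =1 b.
Proof.
elim: n a b => [|m IH] a b aK bK; first by move=> _ [].
rewrite !big_ord_recl /= !expn0 !muln1.
have E (c : 'I_m.+1 -> nat) : (\sum_(i < m) c (lift ord0 i) * K ^ bump 0 i =
    K * \sum_(i < m) c (lift ord0 i) * K ^ i)%N.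
  by rewrite big_distrr; apply: eq_bigr => i _; rewrite /= /bump add1n expnS mulnCA.
rewrite !E => e; have e0 : a ord0 = b ord0.
  move: (congr1 (modn^~ K) e); rewrite !(addnC _ (K * _)%N) !(mulnC K) !modnMDl.
  by rewrite !modn_small.
move: e; rewrite e0 => /addnI /eqP; rewrite eqn_pmul2l; last first.
  exact: leq_ltn_trans (aK ord0).
move=> /eqP /IH h i; case: (unliftP ord0 i) => [j ->|->] //.
by apply: h.
Qed.

(** * Leading monomials and the resulting rank bound *)

Definition wt (w : 'I_n -> nat) (m : monom n) := (\sum_i w i * m i)%N.

Lemma wtD w a b : wt w (madd a b) = (wt w a + wt w b)%N.
Proof. by rewrite /wt -big_split; apply: eq_bigr => i _; rewrite ffunE mulnDr. Qed.

(** The weight compares total degrees first. In the least degree t, ties are broken by reading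
    exponents as digits in base t + 1, which separates the monomials of that degree. *)
Lemma exists_lead f : f <> 0 -> exists w m0, f m0 != 0 /\
  forall m, f m != 0 -> m != m0 -> (wt w m0 < wt w m)%N.
Proof.
move=> f0.
have exd : exists t, `[< exists2 m, mdeg m = t & f m != 0 >].
  have [m fm] : exists m, f m != 0.
    apply: contrapT => /forallNP h; apply: f0; apply/funext => m.
    by apply/eqP/negPn/negP/h.
  by exists (mdeg m); apply/asboolP; exists m.
case: (ex_minnP exd) => t /asboolP[m1 m1t fm1] tmin.
pose dg (m : monom n) := (\sum_i m i * t.+1 ^ i)%N.
have exw : exists s, `[< exists2 m, mdeg m = t /\ dg m = s & f m != 0 >].
  by exists (dg m1); apply/asboolP; exists m1.
case: (ex_minnP exw) => s /asboolP[m0 [m0t m0s] fm0] smin.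
(* One extra unit of degree then outweighs [s], the digit value of the chosen monomial. *)
pose E := s.+1.
have wtE m : wt (fun i => E + t.+1 ^ i)%N m = (E * mdeg m + dg m)%N.
  rewrite /wt /mdeg big_distrr -big_split; apply: eq_bigr => i _ /=.
  by rewrite mulnDl [(_ ^ i * _)%N]mulnC.
exists (fun i => E + t.+1 ^ i)%N, m0; split=> // m fm mm0; rewrite !wtE m0t m0s.
have tm : (t <= mdeg m)%N by apply: tmin; apply/asboolP; exists m.
case: (ltngtP t (mdeg m)) tm => // [ltm _|em _].
  by apply: (@leq_trans (E * t.+1)%N); [rewrite mulnS /E; lia|nia].
rewrite -em ltn_add2l ltn_neqAle smin ?andbT; last first.
  by apply/asboolP; exists m.
apply: contra mm0 => /eqP e; apply/eqP/ffunP; apply: (@digits_inj t.+1).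
- by move=> i; rewrite em ltnS leq_mdeg.
- by move=> i; rewrite -m0t ltnS leq_mdeg.
- by rewrite -/(dg m) -/(dg m0) m0s e.
Qed.

(** The rows x^a f with a + m0 in the box are independent. In a vanishing combination, take a of
    least weight among the nonzero coefficients: the coefficient at a + m0 receives a contribution
    from that row only. *)
Lemma leq_lead_rank q f w m0 : f m0 != 0 ->
  (forall m, f m != 0 -> m != m0 -> (wt w m0 < wt w m)%N) ->
  (count [pred a | madd a m0 \in box n q] (box n q) <= \rank (mulM q f))%N.
Proof.
move=> fm0 lead; pose A := [pred i | madd (bx i) m0 \in box n q] : pred 'I_(size (box n q)).
have -> : count [pred a | madd a m0 \in box n q] (box n q) = #|A|.
  by rewrite -sum1_count (big_nth (mon0 n)) big_mkord sum1_card.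
pose g (l : 'I_#|A|) := enum_val l.
suff : row_free (rowsub g (mulM q f)).
  rewrite /row_free => /eqP <-; apply: mxrankS; apply/row_subP => l.
  by rewrite row_rowsub row_sub.
apply: inj_row_free => v v0; apply/eqP/negPn/negP => vn0.
have [l0 vl0] : exists l, v 0 l != 0.
  apply: contrapT => /forallNP h; move/eqP: vn0; apply; apply/rowP => l.
  by rewrite mxE; apply/eqP/negPn/negP/h.
case: (@arg_minnP _ l0 (fun l => v 0 l != 0) (fun l => wt w (bx (g l))) vl0) => l vl lmin.
have lA : madd (bx (g l)) m0 \in box n q := enum_valP l.
have : (\sum_l' psC (v 0 l') * (psX k (bx (g l')) * f)) (madd (bx (g l)) m0) = 0.
  move: lA; apply: (_ : offbox q _); apply/tr_eq0; rewrite tr_sum -[RHS]v0.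
  rewrite mulmx_sum_row; apply: eq_bigr => l' _.
  by rewrite trC row_rowsub rowK.
rewrite ps_sum (bigD1 l) //= psCM psXM mdvd_madd maddK big1 ?addr0.
  by move/eqP; rewrite mulf_eq0 (negbTE vl) (negbTE fm0).
move=> l' l'l; rewrite psCM psXM; case: ifP => dv; last by rewrite mulr0.
set m' := msub _ _; have em' : madd (bx (g l')) m' = madd (bx (g l)) m0 by apply: msubK.
have [->|vl'] := eqVneq (v 0 l') 0; first by rewrite mul0r.
have [->|fm'] := eqVneq (f m') 0; first by rewrite mulr0.
have [mm|/(lead _ fm') lt] := eqVneq m' m0.
  case/negP: l'l; apply/eqP; apply: enum_val_inj; apply: bx_inj.
  by apply: (@madd_inj _ m0); rewrite !(maddC m0) -em' mm.
have := lmin l' vl'; move: (congr1 (wt w) em'); rewrite !wtD /=; lia.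
Qed.

(** The inequality 1 - sum c_i/q <= prod (1 - c_i/q) with denominators cleared; truncated
    subtraction covers c_i > q as well. *)
Lemma prod_sub_bound q (c : 'I_n -> nat) :
  (q * q ^ n <= q * \prod_i (q - c i) + (\sum_i c i) * q ^ n)%N.
Proof.
elim: n c => [|m IH] c; first by rewrite !big_ord0 mul0n addn0 expn0.
rewrite !big_ord_recl /=; set P := (\prod_(i < m) _)%N; set s := (\sum_(i < m) _)%N.
have := IH (fun i => c (lift ord0 i)); rewrite -/P -/s => h.
have hP : (P <= q ^ m)%N.
  have <- : (\prod_(i < m) q = q ^ m)%N by rewrite prod_nat_const card_ord.
  by apply: leq_prod => i _; exact: leq_subr.
rewrite expnS; set Q := (q ^ m)%N in h hP *.
have : (q * P <= q * Q)%N by rewrite leq_mul2l hP orbT.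
move: (c ord0) => x; nia.
Qed.

Lemma count_box_shift q (m : monom n) :
  count [pred a | madd a m \in box n q] (box n q) = (\prod_i (q - m i))%N.
Proof.
pose A i := [pred x : 'I_q | x < q - m i]%N.
rewrite /box count_map enumT -size_filter.
transitivity #|family A|.
  rewrite cardE /enum_mem; congr (size _); apply: eq_filter => a; rewrite /= mem_box.
  by apply/forallP/familyP => h i; have := h i; rewrite !ffunE !inE ltn_subRL addnC.
rewrite card_family /image_mem foldrE big_map big_enum /=.
apply: eq_bigr => i _; rewrite -sum1_card.
rewrite -(big_ord_widen q (fun=> 1%N) (leq_subr (m i) q)).
by rewrite sum1_card card_ord.
Qed.

End Colength.

(** At most |m0| q^d exponents of the box leave it when shifted by the leading exponent [m0]; all
    others contribute to the rank. *)
Lemma colen_bounded (k : fieldType) d (f : powser k d.+1) : f <> 0 ->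
  exists C, forall q, (0 < q)%N -> (colen q f <= C * q ^ d)%N.
Proof.
move=> /exists_lead[w [m0 [fm0 lead]]]; exists (mdeg m0) => q q0.
have := leq_lead_rank q fm0 lead; rewrite count_box_shift -(leq_pmul2l q0) => hr.
have := prod_sub_bound q m0; rewrite -/(mdeg m0) -(colenE q f) mulnDr colenE expnS.
by rewrite mulnCA => h; rewrite -(leq_pmul2l q0); lia.
Qed.

(** * Square roots of symmetric matrices *)

Lemma closed_sqrt (k : closedFieldType) (z : k) : exists w, w ^+ 2 = z.
Proof.
have [w ww] := @solve_monicpoly k 2 (nth 0 [:: z]) isT; exists w.
by rewrite ww !big_ord_recl big_ord0 /= expr0 expr1 mulr1 mul0r !addr0.
Qed.

(* Induction on the roots: if s^2 = X modulo g, then s + c g is a square root of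
   X modulo g (X - z) as soon as the scalar c solves a quadratic equation, which
   degenerates to a linear one with slope 2 s(z) <> 0 when g(z) = 0. *)
Lemma sqrtX_mod (k : closedFieldType) (rs : seq k) :
  2%:R != 0 :> k -> 0 \notin rs ->
  exists s h : {poly k}, s ^+ 2 = 'X + h * \prod_(z <- rs) ('X - z%:P).
Proof.
move=> k2; elim: rs => [_|z rs IH].
  by exists 0, (- 'X); rewrite big_nil mulr1 subrr expr0n.
rewrite inE negb_or eq_sym => /andP[z0 /IH[s [h e]]]; rewrite big_cons.
set g := \prod_(_ <- rs) _ in e *.
have ez : s.[z] ^+ 2 = z + h.[z] * g.[z].
  by have := congr1 (fun P => P.[z]) e; rewrite !hornerE.
have [c cz] : exists c, h.[z] + 2%:R * c * s.[z] + c ^+ 2 * g.[z] = 0.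
  have [gz|gz] := eqVneq g.[z] 0.
    have sz : s.[z] != 0.
      by apply: contra z0 => /eqP sz; move: ez; rewrite sz gz mulr0 addr0 expr0n => <-.
    exists (- h.[z] / (2%:R * s.[z])); rewrite gz mulr0 addr0; field.
    by rewrite sz k2.
  (* This [c] makes s + c g take at z the value [w], a square root of z. *)
  have [w wz] := closed_sqrt z; exists ((w - s.[z]) / g.[z]).
  have -> : h.[z] = (s.[z] ^+ 2 - w ^+ 2) / g.[z] by rewrite ez wz addrC addKr mulfK.
  by field.
have : root (h + 2%:R *: (c *: s) + c ^+ 2 *: g) z.
  by apply/eqP; rewrite !(hornerD, hornerZ) mulrA cz.
move=> /factor_theorem[h' eh']; exists (s + c *: g), h'.
rewrite -!mul_polyC in eh' *.
have -> : h' * (('X - z%:P) * g) = (h + 2%:R%:P * (c%:P * s) + (c ^+ 2)%:P * g) * g.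
  by rewrite eh' mulrA.
have -> : (s + c%:P * g) ^+ 2 = s ^+ 2 + (2%:R * (c%:P * s) + c%:P ^+ 2 * g) * g by ring.
by rewrite e rmorph_nat rmorphXn /=; ring.
Qed.

Section MatrixSqrt.
Variables (k : closedFieldType) (n d : nat).
Local Notation S := (powser k n).
Hypothesis k2 : 2%:R != 0 :> k.

Definition mx_order_ge N (A : 'M[S]_d.+1) := forall i j, order_ge N (A i j).

Lemma mx_order_geM a b A B :
  mx_order_ge a A -> mx_order_ge b B -> mx_order_ge (a + b) (A * B).
Proof.
move=> hA hB i j; rewrite -[A * B]/(A *m B) mxE.
by apply: order_ge_sum => l _; apply: order_geM.
Qed.

Lemma mx_order_geX N A : mx_order_ge 1 A -> mx_order_ge N (A ^+ N).
Proof. by move=> hA; elim: N => // N IH; rewrite exprS -add1n; apply: mx_order_geM. Qed.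

Lemma tr_horner_mx (C : 'M[S]_d.+1) p : C^T = C -> (horner_mx C p)^T = horner_mx C p.
Proof.
move=> CT; elim/poly_ind: p => [|p c IH]; first by rewrite rmorph0 trmx0.
rewrite rmorphD linearD /= horner_mx_C tr_scalar_mx; congr (_ + _).
rewrite {1}rmorphM /= horner_mx_X -[_ * _]/(_ *m _) trmx_mul CT IH.
by rewrite mulrC rmorphM /= horner_mx_X.
Qed.

(** Let chi be the characteristic polynomial of the constant part of [C]. By Cayley-Hamilton chi(C)
    has entries in the maximal ideal, so chi(C)^N has order at least N, and a square root of X
    modulo chi^N can be evaluated at [C]. Invertibility of the constant part keeps 0 away from the
    roots. *)
Lemma mx_sqrt (C : 'M[S]_d.+1) N : C^T = C ->
  map_mx (@ps_at0 k n) C \in unitmx ->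
  exists2 P : 'M[S]_d.+1, P^T = P & mx_order_ge N (P * P - C).
Proof.
move=> CT C0; set A := map_mx _ _ in C0; set chi := char_poly A.
have [rs chiE] := closed_field_poly_normal chi.
have chi_monic : lead_coef chi = 1 by apply/eqP; apply: char_poly_monic.
rewrite chi_monic scale1r in chiE.
have rs0 : 0 \notin rs.
  apply/negP => h0; have : root chi 0 by rewrite chiE root_prod_XsubC.
  rewrite -eigenvalue_root_char => /eigenvalueP[v]; rewrite scale0r => vA v0.
  by case/negP: v0; rewrite -(mulmxK C0 v) vA mul0mx.
have [|s [h e]] := @sqrtX_mod k (flatten (nseq N rs)) k2.
  by apply/flattenP => -[r /nseqP[-> _]]; apply/negP.
have chiN : \prod_(z <- flatten (nseq N rs)) ('X - z%:P) = chi ^+ N.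
  elim: (N) => [|m IH] /=; first by rewrite big_nil expr0.
  by rewrite big_cat /= IH exprS -chiE.
pose ev p := horner_mx C (map_poly (@psC k n) p).
exists (ev s); first exact: tr_horner_mx.
have -> : ev s * ev s - C = ev h * ev chi ^+ N.
  rewrite -expr2 /ev -!rmorphXn /= e chiN rmorphD /= map_polyX rmorphD /= horner_mx_X.
  by rewrite [C + _]addrC addrK !rmorphM.
rewrite -[N]add0n; apply: mx_order_geM => //; apply: mx_order_geX.
move=> i j; apply/order_ge1P; rewrite /maxideal /=.
have : map_mx (@ps_at0 k n) (ev chi) = 0.
  rewrite /ev map_horner_mx -map_poly_comp map_poly_id => [|c _]; last first.
    by rewrite /= /ps_at0 /psC eqxx.
  exact: Cayley_Hamilton.
by move=> /matrixP/(_ i j); rewrite !mxE.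
Qed.

End MatrixSqrt.

(** * Comparison with the quadric *)

Lemma det_pencil (k : fieldType) r (A B : 'M[k]_r) :
  exists P : {poly k}, forall s, P.[s] = \det (A + s *: B).
Proof.
exists (\det (map_mx polyC A + 'X *: map_mx polyC B)) => s.
rewrite -[LHS]/(horner_eval s _) -det_map_mx; congr (\det _).
by apply/matrixP => i j; rewrite !mxE /= /horner_eval !hornerE.
Qed.

(** Choose [L] and [U] with L A U the identity of size rank A. The determinant of L (A + s B) U is a
    polynomial in s with value 1 at 0, and where it is nonzero the rank has not dropped. *)
Lemma rank_pencil (k : fieldType) D (A B : 'M[k]_D) :
  exists2 P : {poly k}, P != 0 &
    forall s, P.[s] != 0 -> (\rank A <= \rank (A + s *: B)%R)%N.
Proof.
pose L := pinvmx (col_base A); pose U := pinvmx (row_base A).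
have LAU : L *m A *m U = 1%:M.
  have -> : L *m A = row_base A.
    by rewrite -[X in L *m X](mulmx_base A) mulmxA mulVpmx ?col_base_full // mul1mx.
  by rewrite mulmxVp // row_base_free.
have [P PE] := det_pencil (L *m A *m U) (L *m B *m U).
exists P => [|s].
  by apply/eqP => P0; have := PE 0; rewrite P0 horner0 scale0r addr0 LAU det1 => /esym/eqP;
     rewrite oner_eq0.
rewrite PE scalemxAl scalemxAr -mulmxDl -mulmxDr => det0.
have <- : \rank (L *m (A + s *: B) *m U) = \rank A.
  by apply: mxrank_unit; rewrite unitmxE unitfE.
apply: leq_trans (mxrankM_maxl _ _) _; exact: mxrankM_maxr.
Qed.

(** * Substituting another generating family of the maximal ideal *)

Section ChangeOfVariables.
Variables (k : fieldType) (d q : nat).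
Local Notation n := d.+1.
Local Notation S := (powser k n).
Local Notation x i := (psX k (mvar i)).
Hypothesis qp : [pchar k].-nat q.

Definition sqsum (y : 'I_n -> S) : S := \sum_i y i ^+ 2.

Variable y : 'I_n -> S.
Hypothesis ym : forall i, maxideal (y i).
Hypothesis xy : forall i, exists w : 'I_n -> S, x i = \sum_j w j * y j.

Definition ymon (a : monom n) : S := \prod_i y i ^+ a i.

Lemma ymonD a b : ymon (madd a b) = ymon a * ymon b.
Proof. by rewrite /ymon -big_split; apply: eq_bigr => i _; rewrite ffunE exprD. Qed.

Lemma ymon_var i : ymon (mvar i) = y i.
Proof.
rewrite /ymon (bigD1 i) //= ffunE eqxx expr1 big1 ?mulr1 // => j ji.
by rewrite ffunE (negbTE ji).
Qed.

Lemma ymon_off a : a \notin box n q -> offbox q (ymon a).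
Proof.
rewrite mem_box negb_forall => /existsP[i]; rewrite -leqNgt => qi.
rewrite /ymon (bigD1 i) //= mulrC -(subnK qi) exprD.
by apply: offboxM; apply: offboxM; apply: maxideal_frob.
Qed.

(* The matrix of the endomorphism x_i |-> y_i of S / m^[q]. *)
Definition substM : 'M[k]_(size (box n q)) := \matrix_i tr q (ymon (bx i)).

Lemma tr_psX_subst a : tr q (psX k a) *m substM = tr q (ymon a).
Proof.
have [/bxP[i <-]|aq] := boolP (a \in box n q); first by rewrite tr_psX -rowE rowK.
by rewrite !(proj2 (tr_eq0 q _)) ?mul0mx //; [apply: ymon_off|apply: offbox_psX].
Qed.

Lemma ymon_sub a : (tr q (ymon a) <= substM)%MS.
Proof. by rewrite -tr_psX_subst submxMl. Qed.

(** Surjectivity of the substitution by successive approximation: write F = F(0) + sum w_j y_j and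
    approximate each w_j. Multiplying by y_j gains one order. *)
Lemma approx_subst N (F : S) :
  exists2 G, (tr q G <= substM)%MS & order_ge N (F - G).
Proof.
elim: N F => [|N IH] F; first by exists 0; rewrite ?(proj2 (tr_eq0 q _)) ?sub0mx.
have [|H FH _] := @order_ge_split k n 0 (F - psC (ps_at0 F)).
  by apply/order_ge1P; rewrite /maxideal /= psB /psC eqxx subrr.
have [w wE] : exists w : 'I_n -> S, F - psC (ps_at0 F) = \sum_j w j * y j.
  have [W WE] := choice xy; exists (fun j => \sum_i H i * W i j).
  rewrite FH; under [RHS]eq_bigr do rewrite mulr_suml.
  rewrite exchange_big; apply: eq_bigr => i _; rewrite WE mulrC mulr_sumr.
  by apply: eq_bigr => j _; rewrite mulrA.
have [G GE] := choice (fun j => (let: ex_intro2 G a b := IH (w j) in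
   ex_intro (fun G => (tr q G <= substM)%MS /\ order_ge N (w j - G)) G (conj a b))).
exists (psC (ps_at0 F) * ymon (mon0 n) + \sum_j G j * y j).
  rewrite trD trC addmx_sub //; first by rewrite scalemx_sub // ymon_sub.
  rewrite tr_sum summx_sub // => j _; have /submxP[v vE] := (GE j).1.
  (* The image is stable under multiplication by y_j: each product of y's gains one factor, and if
     its exponent leaves the box its truncation is zero. *)
  have -> : tr q (G j * y j) = tr q (\sum_i psC (v 0 i) * ymon (madd (bx i) (mvar j))).
    rewrite trM vE [v *m _]mulmx_sum_row mulmx_suml tr_sum; apply: eq_bigr => i _.
    by rewrite -scalemxAl rowK -trM trC ymonD ymon_var.
  by rewrite tr_sum summx_sub // => i _; rewrite trC scalemx_sub // ymon_sub.
have -> : F - (psC (ps_at0 F) * ymon (mon0 n) + \sum_j G j * y j) =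
    \sum_j (w j - G j) * y j.
  have -> : ymon (mon0 n) = 1.
    by rewrite /ymon big1 // => i _; rewrite ffunE expr0.
  rewrite mulr1 opprD addrA wE -sumrB; apply: eq_bigr => j _.
  by rewrite mulrBl.
apply: order_ge_sum => j _; rewrite -[N.+1]addn1; apply: order_geM; first exact: (GE j).2.
exact/order_ge1P.
Qed.

(** Order n q already forces a series off the box, so approximation to that order reaches every
    basis vector, and a surjective square matrix is invertible. *)
Lemma substM_unit : substM \in unitmx.
Proof.
rewrite -row_full_unit -sub1mx; apply/row_subP => i; rewrite row1 -tr_psX.
have [G GE /order_ge_offbox h] := approx_subst (n * q) (psX k (bx i)).
by have /tr_eq -> := h isT.
Qed.

(** The substitution intertwines multiplication by the sum of the x_i^2 with multiplication by [g],
    and being invertible it preserves rank. *)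
Lemma rank_sqsum g : offbox q (g - sqsum y) ->
  \rank (mulM q (sqsum (fun i : 'I_n => x i))) = \rank (mulM q g).
Proof.
move=> gy; have fy : row_free substM by rewrite row_free_unit substM_unit.
have uy : row_full substM by rewrite row_full_unit substM_unit.
rewrite -(mxrankMfree _ fy) -(eqmxMfull (mulM q g) uy) (mulM_eq gy).
congr mxrank; apply/row_matrixP => i; rewrite !row_mul !rowK -trM.
rewrite !mulr_sumr !tr_sum mulmx_suml; apply: eq_bigr => l _.
by rewrite !expr2 -!psXD tr_psX_subst !ymonD !ymon_var.
Qed.

End ChangeOfVariables.

(** * Quadratic forms over the power series ring and their diagonalization *)

Section Morse.
Variables (k : closedFieldType) (d q : nat).
Local Notation n := d.+1.
Local Notation S := (powser k n).
Local Notation x i := (psX k (mvar i)).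
Hypothesis k2 : 2%:R != 0 :> k.
Hypothesis qp : [pchar k].-nat q.

Definition xcol : 'cV[S]_n := \col_i x i.
Definition qform (B : 'M[S]_n) : S := (xcol^T *m B *m xcol) 0 0.

Lemma qformE B : qform B = \sum_j \sum_i x i * B i j * x j.
Proof.
rewrite /qform mxE; apply: eq_bigr => j _; rewrite !mxE mulr_suml.
by apply: eq_bigr => i _; rewrite !mxE.
Qed.

(** Splitting off a variable twice gives f = sum x_i x_j H_ij; averaging H with its transpose uses
    that 2 is invertible. *)
Lemma qform_exists f : order_ge 2 f -> exists2 B, B^T = B & f = qform B.
Proof.
move=> /order_ge_split[G fG oG].
have /choice[H HE] i : exists h : 'I_n -> S, G i = \sum_j x j * h j.
  by have [h hE _] := order_ge_split (oG i); exists h.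
pose B : 'M[S]_n := \matrix_(i, j) (psC 2%:R^-1 * (H i j + H j i)).
exists B; first by apply/matrixP => i j; rewrite !mxE addrC.
have f1 : f = \sum_i \sum_j x i * H i j * x j.
  rewrite fG; apply: eq_bigr => i _; rewrite HE mulr_sumr.
  by apply: eq_bigr => j _; rewrite -mulrA [H i j * _]mulrC.
have f2 : f = \sum_j \sum_i x i * H j i * x j.
  by rewrite {1}f1; apply: eq_bigr => j _; apply: eq_bigr => i _; ring.
have -> : f = psC 2%:R^-1 * (f + f).
  rewrite -mulr2n -[f *+ 2]mulr_natl mulrA -(rmorph_nat (@psC k n)) -rmorphM mulVf //.
  by rewrite rmorph1 mul1r.
rewrite {1}f1 exchange_big {1}f2 -big_split mulr_sumr qformE; apply: eq_bigr => j _.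
rewrite -big_split mulr_sumr; apply: eq_bigr => i _ /=; rewrite mxE; ring.
Qed.

Lemma rank_nondegenerate (C : 'M[S]_n) : C^T = C ->
  map_mx (@ps_at0 k n) C \in unitmx ->
  \rank (mulM q (sqsum (fun i : 'I_n => x i))) = \rank (mulM q (qform C)).
Proof.
(* Order n q kills the error modulo m^[q]; the extra one makes the precision positive, so that
   constant terms satisfy P(0)^2 = C(0). *)
move=> CT C0; have [P PT PC] := mx_sqrt k2 (n * q).+1 CT C0.
pose y i := (P *m xcol) i 0.
have detP : (\det P) (mon0 n) != 0.
  have e : map_mx (@ps_at0 k n) P *m map_mx (@ps_at0 k n) P = map_mx (@ps_at0 k n) C.
    rewrite -map_mxM; apply/matrixP => i j; rewrite !mxE; apply/eqP; rewrite -subr_eq0.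
    apply/eqP; have := PC i j (mon0 n); rewrite !mxE; apply.
    by rewrite (eqP (_ : mdeg (mon0 n) == 0)%N) // mdeg_eq0.
  move: C0; rewrite -e unitmx_mul => /andP[+ _].
  by rewrite unitmxE det_map_mx unitfE.
have [W WP] := ps_unit detP.
apply: (@rank_sqsum _ _ _ qp y).
- move=> i; apply/order_ge1P; rewrite /y mxE; apply: order_ge_sum => j _.
  apply: (@order_geM _ _ 0 1) => //; rewrite mxE.
  by apply/order_ge1P; apply: maxideal_psX.
(* The adjugate identity recovers x from y = P x, as [W] inverts det P. *)
- move=> i; exists (fun j => W * (\adj P) i j).
  have := congr1 (fun M : 'cV[S]_n => W * M i 0) (mulmxA (\adj P) P xcol).
  rewrite mul_adj_mx mul_scalar_mx !mxE mulrA WP mul1r => <-.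
  by rewrite mulr_sumr; apply: eq_bigr => j _; rewrite mulrA.
have -> : sqsum y = qform (P *m P).
  rewrite /qform mulmxA -{1}PT -trmx_mul -mulmxA mxE; apply: eq_bigr => i _.
  by rewrite expr2 mxE.
apply: order_ge_offbox => //.
have -> : qform C - qform (P *m P) = \sum_j \sum_i x i * (C - P *m P) i j * x j.
  rewrite !qformE -sumrB; apply: eq_bigr => j _; rewrite -sumrB; apply: eq_bigr => i _.
  have -> : (C - P *m P) i j = C i j - (P *m P) i j by rewrite !mxE.
  by ring.
apply: order_ge_sum => j _; apply: order_ge_sum => i _.
rewrite -[(n * q)%N]addn0; apply: order_geM => //.
apply: (@order_geM _ _ 0 (n * q)) => // m mq.
rewrite -opprB mxE psN PC ?oppr0 //.
exact: ltnW.
Qed.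

Lemma colen_sqsum_leq (f : S) : order_ge 2 f ->
  (colen q (sqsum (fun i : 'I_n => x i)) <= colen q f)%N.
Proof.
move=> /qform_exists[B BT fB]; apply: leq_sub2l.
set Q := sqsum _.
have [P1 P10 P1r] := rank_pencil (mulM q f) (mulM q Q).
(* The roots of [P2] are exactly the scalars s for which B(0) + s is singular. *)
pose B0 := map_mx (@ps_at0 k n) B; pose P2 := char_poly (- B0).
have P20 : P2 != 0 by apply: monic_neq0; apply: char_poly_monic.
have [s] : exists s, ~~ root (P1 * P2) s.
  by apply/closed_nonrootP; rewrite mulf_neq0.
rewrite rootM negb_or => /andP[/P1r rs ns].
apply: leq_trans rs _; rewrite -mulMC -mulMD.
have -> : f + psC s * Q = qform (B + (psC s)%:M).
  rewrite fB /qform mulmxDr mulmxDl [RHS]mxE; congr (_ + _).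
  rewrite mul_mx_scalar -scalemxAl !mxE; congr (_ * _).
  by apply: eq_bigr => i _; rewrite !mxE expr2.
rewrite (@rank_nondegenerate (B + (psC s)%:M)) //.
- by rewrite linearD /= tr_scalar_mx BT.
move: ns; rewrite -eigenvalue_root_char /eigenvalue /eigenspace kermx_eq0 negbK.
rewrite row_free_unit -opprD -scaleN1r unitmxZ ?unitrN ?unitr1 // => h.
rewrite map_mxD map_scalar_mx /= {2}/ps_at0 /psC eqxx //.
Qed.

End Morse.

(** * Hilbert-Kunz multiplicity *)

Lemma mdeg1P n (m : monom n) : mdeg m = 1%N -> exists i, m = mvar i.
Proof.
move=> m1; have [i mi] : exists i, (0 < m i)%N.
  apply: contrapT => /forallNP h; have : mdeg m == 0%N.
    by rewrite /mdeg big1 // => i _; apply/eqP; rewrite -leqn0 leqNgt; apply/negP/h.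
  by rewrite m1.
exists i; have dv : mdvd (mvar i) m.
  by apply/mdvdP => j; rewrite ffunE; case: eqP => // ->.
have : mdeg (msub m (mvar i)) == 0%N.
  by rewrite -(eqn_add2l (mdeg (mvar i))) -mdegD msubK // m1 mdeg_var.
by rewrite mdeg_eq0 => /eqP e; rewrite -(msubK dv) e maddC madd0m.
Qed.

(** By contraposition: if some x_i has a nonzero coefficient in the linear part of [f], then [f] and
    the d other variables generate the maximal ideal. *)
Lemma singular_order_ge2 (k : fieldType) d (f : powser k d.+1) : maxideal f ->
  ~ (exists g : 'I_d -> powser k d.+1,
       ideal_gen ([set f] `|` range g) = @maxideal k d.+1) ->
  order_ge 2 f.
Proof.
move=> fm sing m; rewrite ltnS leq_eqVlt ltnS leqn0 mdeg_eq0.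
case/orP => [/eqP/mdeg1P[i ->]|/eqP -> //].
apply/eqP/negPn/negP => fi; apply: sing.
exists (fun j => psX k (mvar (lift i j))); apply/seteqP; split=> F.
  apply; first apply/is_idealE; first split=> //.
  - by move=> G H G0 H0; rewrite /maxideal /= psD G0 H0 addr0.
  - by move=> s G G0; rewrite /maxideal /= ps_at0M G0 mulr0.
  by move=> G [->//|[j _ <-]]; apply: maxideal_psX.
move=> /order_ge1P/order_ge_split[G -> _] I /is_idealE[I0 ID IM] HI.
have Ij j : j != i -> I (psX k (mvar j)).
  case: (unliftP i j) => [l -> _|->]; last by rewrite eqxx.
  by apply: HI; right; exists l.
suff Ix j : I (psX k (mvar j)).
  by apply: (big_ind I) => // j _; rewrite mulrC; apply: (IM).
have [->|/Ij//] := eqVneq j i.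
have [H fH _] : exists2 H : 'I_d.+1 -> powser k d.+1, f = \sum_i psX k (mvar i) * H i
    & forall i, order_ge 0 (H i) by apply: order_ge_split; apply/order_ge1P.
(* The constant term of [H i] is the coefficient of x_i in [f], so [H i] is a unit and f = sum x_l
   H_l can be solved for x_i. *)
have Hi : H i (mon0 d.+1) != 0.
  suff <- : f (mvar i) = H i (mon0 d.+1) by [].
  rewrite fH ps_sum (bigD1 i) //= psXM big1 ?addr0 => [|l li]; last first.
    rewrite psXM; case: mdvdP => // /(_ l).
    by rewrite !ffunE eqxx (negbTE li).
  case: mdvdP => [_|[]//]; congr (H i _); apply/ffunP => l; by rewrite !ffunE subnn.
have [W WH] := ps_unit Hi.
have -> : psX k (mvar i) =
    W * (f + (-1) * \sum_(l | l != i) H l * psX k (mvar l)).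
  have -> : f = psX k (mvar i) * H i + \sum_(l | l != i) H l * psX k (mvar l).
    by rewrite {1}fH (bigD1 i) //=; congr (_ + _); apply: eq_bigr => l _; rewrite mulrC.
  by rewrite mulN1r addrK mulrCA WH mulr1.
apply: (IM); apply: (ID); first by apply: HI; left.
by apply: (IM); apply: (big_ind I) => // l li; apply: (IM); apply: Ij.
Qed.

Lemma quadricE (k : fieldType) d :
  @quadric k d.+1 = sqsum (fun i : 'I_d.+1 => psX k (mvar i)).
Proof.
rewrite /sqsum -big_enum /= /quadric; elim: (enum _) => [|i s IH] /=.
  by rewrite big_nil.
by rewrite big_cons IH.
Qed.

Lemma quadric_neq0 (k : fieldType) d : @quadric k d.+1 <> 0.
Proof.
pose m := madd (mvar (@ord0 d)) (mvar ord0).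
rewrite quadricE => /(congr1 (fun F : powser k d.+1 => F m)).
rewrite /= /sqsum ps_sum (bigD1 ord0) //= expr2 -psXD /psX eqxx big1 ?addr0 => [|i i0].
  by move/eqP; rewrite oner_eq0.
rewrite expr2 -psXD /psX; case: eqP => // /ffunP/(_ i).
by rewrite !ffunE eqxx (negbTE i0).
Qed.

Section HilbertKunz.
Variables (R : realType) (k : fieldType) (p d : nat).
Hypothesis pk : p \in [pchar k].

Lemma pchar_natX e : [pchar k].-nat (p ^ e)%N.
Proof. by rewrite pnatX pnatE ?pk // (pcharf_prime pk). Qed.

Definition hk_seq (f : powser k d.+1) : R^nat :=
  fun e => (colen (p ^ e) f)%:R / ((p ^ e) ^ d)%:R.

Lemma eHK_colen f : eHK R p f = limn (hk_seq f).
Proof.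
congr (limn _); apply/funext => e; rewrite /hk_seq.
by rewrite frob_qlength ?pchar_natX // /colen -(size_box d.+1 (p ^ e)).
Qed.

Lemma is_cvg_hk_seq f : f <> 0 -> cvgn (hk_seq f).
Proof.
move=> f0; have p0 e : (0 < p ^ e)%N by rewrite expn_gt0 prime_gt0 // (pcharf_prime pk).
have pd0 e : 0 < ((p ^ e) ^ d)%:R :> R by rewrite ltr0n expn_gt0 p0.
apply: nondecreasing_is_cvgn.
  apply/nondecreasing_seqP => e; rewrite /hk_seq ler_pdivrMr //.
  rewrite -mulrAC ler_pdivlMr // -!natrM ler_nat expnS expnMn.
  (* There are d + 1 variables, so cancelling one factor p leaves p^d, the growth of the denominator
     from e to e + 1. *)
  have := colen_frob (p ^ e) f (pchar_natX 1); rewrite expn1 expnS -mulnA.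
  have := p0 1%N; rewrite expn1 => p0'; rewrite leq_pmul2l // => h.
  by rewrite mulnA [(colen _ f * _)%N]mulnC leq_mul2r h orbT.
have [C hC] := colen_bounded f0; exists C%:R => _ [e _ <-].
by rewrite /hk_seq ler_pdivrMr // -natrM ler_nat hC.
Qed.

End HilbertKunz.

Theorem theorem3p2 (R : realType) (k : closedFieldType) (p d : nat)
  (f : powser k d.+1)
  (Hunc : uncountable k)
  (Hp : p \in [pchar k]%R) (Hp2 : p != 2%N)
  (Hf0 : f <> @ps_zero k d.+1)
  (Hfm : @maxideal k d.+1 f)
  (Hsing : ~ exists g : 'I_d -> powser k d.+1,
             ideal_gen ([set f] `|` range g) = @maxideal k d.+1) :
  eHK R p (@quadric k d.+1) <= eHK R p f.
Proof.
have k2 : 2%:R != 0 :> k.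
  apply: contra Hp2 => k20; have : 2%N \in [pchar k] by rewrite inE /= k20.
  by rewrite (pcharf_eq Hp) => /eqP <-.
rewrite !(eHK_colen _ Hp); apply: ler_lim.
- by apply: is_cvg_hk_seq => //; apply: quadric_neq0.
- exact: is_cvg_hk_seq.
near=> e; rewrite /hk_seq ler_wpM2r ?invr_ge0 ?ler0n // ler_nat quadricE.
apply: colen_sqsum_leq => //; first exact: pchar_natX.
exact: singular_order_ge2.
Unshelve. all: by end_near.
Qed.
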